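(* Let $\mathbb{F}$ be a field and let $V$ be an infinite-dimensional $\mathbb{F}$-vector space. Then every endomorphism of $V$ is the sum of four square-zero endomorphisms of $V$, and every endomorphism of $V$ is the sum of four idempotent endomorphisms of $V$.
   Context: $\mathbb{F}$ is an arbitrary field. An endomorphism of $V$ is an $\mathbb{F}$-linear map $V\to V$. An endomorphism $v$ is square-zero if $v^2=0$, and idempotent if $v^2=v$. *)

(* Defs.v *)
From mathcomp Require Import all_boot all_order all_algebra.

Set Implicit Arguments.
Unset Strict Implicit.
Unset Printing Implicit Defensive.

Import GRing.Theory.
Local Open Scope ring_scope.

(* No finite family spans V. MathComp's own dimension theory (vectType) only
   covers finite-dimensional spaces. *)
Definition infinite_dimensional (F : fieldType) (V : lmodType F) : Prop :=
  ~ exists (n : nat) (e : 'I_n -> V),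
      forall x : V, exists c : 'I_n -> F, x = \sum_(i < n) c i *: e i.

Definition square_zero (F : fieldType) (V : lmodType F)
    (v : {linear V -> V}) : Prop :=
  v \o v =1 \0.

(* Main.v *)
(* Both claims are the cases e = 0 and e = 1 of: every u is a sum of four
   endomorphisms satisfying a^2 = e a.  If v exchanges the two summands of a
   decomposition of V, then v + e is a sum of two such endomorphisms, namely
   the triangular matrices [[e, N], [0, 0]] and [[0, 0], [M, e]].  So it is
   enough to write w = u - 2e as a sum of two endomorphisms, each exchanging
   the summands of its own decomposition.  Identify V with V + V.  A conjugate
   of an off-diagonal matrix can have the same diagonal entries as w, because
   commutators with a suitable surjective, locally nilpotent endomorphism of V
   exhaust End(V); the remaining difference is off-diagonal. *)
Require Import Defs.
From HB Require Import structures.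
From mathcomp Require Import all_boot all_order all_algebra.
From mathcomp Require Import boolp classical_sets functions cardinality.

Set Implicit Arguments.
Unset Strict Implicit.
Unset Printing Implicit Defensive.

Import GRing.Theory.

(** * Infinite sets as disjoint unions of sequences *)

(* A maximal family of disjoint injective sequences in B misses only finitely
   many points, which are prepended to one of the sequences. *)
Lemma infinite_set_sequences (T : eqType) (B : set T) : infinite_set B ->
  exists (J : Type) (e : J -> nat -> T),
    (forall x, B x <-> exists j n, x = e j n) /\
    (forall i j m n, e i m = e j n -> i = j /\ m = n).
Proof.
move=> infB.
(* The second clause covers both injectivity of each sequence and disjointness of any two; it
   concerns two members at a time, so it passes to unions of chains. *)
pose P (X : set (nat -> T)) := (forall f, X f -> forall n, B (f n)) /\
  (forall f g m n, X f -> X g -> f m = g n -> f = g /\ m = n).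
have [Fs FP totF|A [[AB Ainj] maxA]] := @Zorn_bigcup _ P.
  split=> [f [X FX Xf]|f g m n [X FX Xf] [Y FY Yg]]; first exact: (FP X FX).1.
  have [XY|YX] := totF _ _ FX FY; first exact: (FP Y FY).2 (XY f Xf) Yg.
  exact: (FP X FX).2 Xf (YX g Yg).
pose covered x := exists2 f, A f & exists n, x = f n.
pose R := (B `\` covered)%classic.
have finR : finite_set R.
  (* Were [R] infinite, an injective sequence [h] inside it could join the maximal family [A]. *)
  apply: contrapT => /infiniteP/card_leP[/= f].
  pose h n := val (f (exist _ n (mem_set I))).
  have hR n : R (h n) by exact: set_mem (valP (f _)).
  have h_inj m n : h m = h n -> m = n.
    by move=> /val_inj/inj; rewrite !mem_set // => /(_ isT isT)[].
  apply: (maxA (A `|` [set h])%classic).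
    split=> [g Ag|/(_ h (or_intror erefl)) Ah]; first by left.
    by apply: (hR 0).2; exists h => //; exists 0.
  have hA g m n : A g -> h m <> g n.
    by move=> Ag hg; apply: (hR m).2; exists g => //; exists n.
  split=> [g [/AB//|-> n]|g g' m n]; first exact: (hR n).1.
  move=> [Ag|->] [Ag'|->] eq_gg'; first exact: Ainj eq_gg'.
  - by case: (hA g n m Ag).
  - by case: (hA g' m n Ag').
  - by split=> //; exact: h_inj.
have [r0 Rr0] := (finite_seqP R).1 finR; pose r := undup r0.
have Rr x : R x <-> x \in r by rewrite mem_undup Rr0.
have [f0 Af0] : exists f0, A f0.
  apply: contrapT => A0; apply: infB; suff <- : R = B by [].
  apply/seteqP; split=> [x []//|x Bx]; split=> //.
  by case=> f Af; case: A0; exists f.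
pose J := {f | A f}; pose k := size r.
(* [r] is put in front of [f0] alone, shifting it by [k]; [nth] is read only below [k], so its
   default [f0 0] never appears. *)
pose e (j : J) n := if pselect (sval j = f0) then
    (if n < k then nth (f0 0) r n else f0 (n - k)) else sval j n.
have e_covered (j : J) n : ~ (sval j = f0 /\ n < k) ->
    e j n = sval j (if pselect (sval j = f0) then n - k else n).
  by rewrite /e; case: pselect => //= ->; case: ltnP => // nk [].
have e_rest (j : J) n : sval j = f0 -> n < k -> R (e j n).
  by rewrite /e; case: pselect => //= _ _ nk; rewrite nk; apply/Rr/mem_nth.
have not_both x : R x -> covered x -> False by case.
have sval_inj (i j : J) : sval i = sval j -> i = j.
  by move: i j => [f Af] [g Ag] /= fg; exact: eq_exist.
exists J, e; split=> [x|i j m n].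
  split=> [Bx|[[f Af] [n ->]]].
    have [[f Af [n ->]]|ncov] := pselect (covered x).
      exists (exist _ f Af); exists (if pselect (f = f0) then n + k else n).
      rewrite e_covered /=; case: pselect => //= ff0; first by rewrite addnK.
        by case=> _; rewrite ltnNge leq_addl.
      by case.
    have xr : x \in r by apply/Rr.
    exists (exist _ f0 Af0), (index x r); rewrite /e /=; case: pselect => //= _.
    by rewrite index_mem xr nth_index.
  have [[ff0 nk]|ff0] := pselect (f = f0 /\ n < k).
    by case: (e_rest (exist _ f Af) n ff0 nk).
  by rewrite e_covered //=; apply: AB.
(* The prefix lies in [R] and all other values are covered, so the two mixed cases are
   impossible. *)
have [im|im] := pselect (sval i = f0 /\ m < k);
  have [jn|jn] := pselect (sval j = f0 /\ n < k).
- case: im jn => [i0 mk] [j0 nk]; rewrite /e.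
  case: pselect => //; case: pselect => //= _ _.
  rewrite mk nk => /eqP; rewrite nth_uniq ?undup_uniq // => /eqP ->.
  by split=> //; apply: sval_inj; rewrite i0 j0.
- move=> eq_e; case: (not_both (e i m)); first exact: e_rest im.1 im.2.
  rewrite eq_e e_covered //; exists (sval j); first exact: svalP.
  by eexists.
- move=> eq_e; case: (not_both (e j n)); first exact: e_rest jn.1 jn.2.
  rewrite -eq_e e_covered //; exists (sval i); first exact: svalP.
  by eexists.
rewrite !e_covered // => /(Ainj _ _ _ _ (svalP i) (svalP j))[ij].
have -> : i = j by exact: sval_inj.
move: im jn; rewrite ij; case: pselect => //= j0.
move=> /not_andP[//|/negP]; rewrite -leqNgt => km.
move=> /not_andP[//|/negP]; rewrite -leqNgt => kn eq_mn; split=> //.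
by rewrite -(subnK km) eq_mn subnK.
Qed.

Local Open Scope ring_scope.

(** * Endomorphisms as two-by-two block matrices *)

Lemma pack_linear (F : fieldType) (V : lmodType F) (f : V -> V) :
  linear f -> exists g : {linear V -> V}, g =1 f.
Proof.
move=> lin_f; pose m := GRing.isLinear.Build F V V *:%R f lin_f.
by exists (HB.pack f m : {linear V -> V}).
Qed.

Section Blocks.
Variables (F : fieldType) (V : lmodType F).
Implicit Types (u v h b T : {linear V -> V}) (e : F).

(** An isomorphism of V with V + V, given by injections and projections; the composites
    [p \o v \o i] are the matrix entries of v. *)
Record split_twice (i0 i1 p0 p1 : {linear V -> V}) : Prop := SplitTwice {
  split00 : forall x, p0 (i0 x) = x;
  split11 : forall x, p1 (i1 x) = x;
  split01 : forall x, p0 (i1 x) = 0;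
  split10 : forall x, p1 (i0 x) = 0;
  split_sum : forall x, i0 (p0 x) + i1 (p1 x) = x }.

Lemma off_diagonal_quadratic_sum e (i0 i1 p0 p1 v : {linear V -> V}) :
  split_twice i0 i1 p0 p1 ->
  (forall x, p0 (v (i0 x)) = 0) -> (forall x, p1 (v (i1 x)) = 0) ->
  exists a b : {linear V -> V},
    [/\ forall x, a (a x) = e *: a x, forall x, b (b x) = e *: b x
      & forall x, v x + e *: x = a x + b x].
Proof.
case=> s00 s11 s01 s10 ss v00 v11.
(* The two rows of the matrix of v + e, whose diagonal entries are e. *)
exists (i0 \o ((e \*: p0) \+ (p0 \o v \o i1 \o p1))).
exists (i1 \o ((e \*: p1) \+ (p1 \o v \o i0 \o p0))).
split=> x /=.
- by rewrite s00 s10 !linear0 addr0 linearZ.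
- by rewrite s11 s01 !linear0 addr0 linearZ.
rewrite !linearD !linearZ /= addrACA -scalerDr ss addrC; congr (_ + _).
have pv (q : {linear V -> V}) : q (v x) = q (v (i0 (p0 x))) + q (v (i1 (p1 x))).
  by rewrite -!linearD ss.
by rewrite -[LHS]ss !pv v00 v11 add0r addr0.
Qed.

(** The new injections are the columns of [[1, 0], [h, 1]] [[1, 1], [0, 1]] = [[1, 1], [h, 1 + h]],
    the new projections the rows of its inverse [[1 + h, -1], [-h, 1]]. *)
Lemma split_twice_conj h (i0 i1 p0 p1 : {linear V -> V}) :
  split_twice i0 i1 p0 p1 ->
  split_twice (i0 \+ (i1 \o h)) (i0 \+ (i1 \o (idfun \+ h)))
              (p0 \- (p1 \- (h \o p0))) (p1 \- (h \o p0)).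
Proof.
case=> s00 s11 s01 s10 ss.
have p0E x y : p0 (i0 x + i1 y) = x by rewrite linearD s00 s01 addr0.
have p1E x y : p1 (i0 x + i1 y) = y by rewrite linearD s10 s11 add0r.
split=> x /=; rewrite ?p0E ?p1E ?addrK ?subrr ?subr0 //.
rewrite addrACA -linearD subrK -linearD addrCA -linearD subrK subrK.
exact: ss.
Qed.

(** The series h = - sum of s^(k+1) T b^k over k >= 0 is finite at every vector. As b s = 1,
    composing with b on the left lowers the power of s: b h = h b - T. *)
Lemma commutator_with_left_inverse (s b T : {linear V -> V}) :
  (forall x, b (s x) = x) -> (forall x, exists n, iter n b x = 0) ->
  exists h : {linear V -> V}, forall x, h (b x) - b (h x) = T x.
Proof.
move=> bs /choice[n bn0].
pose H m x := - \sum_(k < m) iter k.+1 s (T (iter k b x)).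
have iter_lin k (g : {linear V -> V}) : linear (iter k g).
  by elim: k => // k IH c x y; rewrite !iterS IH linearP.
have iter0 k (g : {linear V -> V}) : iter k g 0 = 0.
  by elim: k => //= k ->; rewrite linear0.
have H_stable x m : (n x <= m)%N -> H m x = H (n x) x.
  move=> /subnKC <-; rewrite /H; congr (- _); rewrite big_split_ord /=.
  rewrite [X in _ + X]big1 ?addr0 // => k _.
  suff -> : iter (n x + k) b x = 0 by rewrite linear0 iter0 linear0.
  by rewrite addnC iterD bn0 iter0.
have H_lin m : linear (H m).
  move=> c x y; rewrite /H scalerN -opprD scaler_sumr -big_split /=.
  congr (- _); apply: eq_bigr => k _.
  by rewrite iter_lin linearP iter_lin linearP.
have [|h hE] := @pack_linear F V (fun x => H (n x) x).
  move=> c x y; pose m := (n (c *: x + y)%R + n x + n y)%N.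
  rewrite -(@H_stable _ m) -?(@H_stable x m) -?(@H_stable y m) ?H_lin //.
  - by rewrite leq_addl.
  - by rewrite /m addnAC leq_addl.
  - by rewrite /m -addnA leq_addr.
exists h => x; rewrite !hE; pose m := (n x + n (b x))%N.
(* One more term is taken at [x] than at [b x]: once the term k = 0 has given [T x], the two sums
   match. *)
rewrite -(@H_stable _ m) ?leq_addl // -(@H_stable x m.+1); last first.
  by rewrite (leq_trans (leq_addr _ _) (leqnSn _)).
rewrite /H linearN opprK big_ord_recl /= !linearD bs (linear_sum b) /=.
rewrite addrCA [X in _ + X](_ : _ = 0) ?addr0 //.
rewrite addrC; apply/eqP; rewrite subr_eq0; apply/eqP; apply: eq_bigr => k _.
by rewrite bs -iterSr.
Qed.

(* Conjugating the off-diagonal matrix [[0, N], [M, 0]] first by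
   [[1, 1], [0, 1]] and then by [[1, 0], [k, 1]] yields the diagonal entries
   M - (N - M)k and k(N - M) - M.  With N - M = p1, M = p1 h and
   k = h - i1 A these are A and h p1 - p1 h - i1 A p1, and the commutator
   h p1 - p1 h can be prescribed. *)
Lemma off_diagonal_part (i0 i1 p0 p1 u : {linear V -> V}) :
  split_twice i0 i1 p0 p1 -> (forall x, exists n, iter n p1 x = 0) ->
  exists v j0 j1 q0 q1 : {linear V -> V},
    [/\ split_twice j0 j1 q0 q1,
        forall x, q0 (v (j0 x)) = 0, forall x, q1 (v (j1 x)) = 0,
        forall x, p0 (v (i0 x)) = p0 (u (i0 x))
      & forall x, p1 (v (i1 x)) = p1 (u (i1 x))].
Proof.
move=> sp nil; have [s00 s11 s01 s10 ss] := sp.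
pose A : {linear V -> V} := p0 \o (u \o i0).
pose D : {linear V -> V} := p1 \o (u \o i1).
(* The term [i1 \o (A \o p1)] offsets the correction that turns [h] into [k]. *)
have [h hP] :=
  commutator_with_left_inverse (D \+ (i1 \o (A \o p1))) s11 nil.
pose k : {linear V -> V} := h \- (i1 \o A).
pose M : {linear V -> V} := p1 \o h.
pose N : {linear V -> V} := p1 \+ M.
have spk := split_twice_conj k sp.
pose j0 : {linear V -> V} := i0 \+ (i1 \o k).
pose j1 : {linear V -> V} := i0 \+ (i1 \o (idfun \+ k)).
pose q1 : {linear V -> V} := p1 \- (k \o p0).
pose q0 : {linear V -> V} := p0 \- q1.
pose v : {linear V -> V} := (j0 \o (N \o q1)) \+ (j1 \o (M \o q0)).
exists v, j0, j1, q0, q1.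
have [t00 t11 t01 t10 ts] : split_twice j0 j1 q0 q1 := spk.
have p0j0 x : p0 (j0 x) = x by rewrite /j0 /= linearD s00 s01 addr0.
have p0j1 x : p0 (j1 x) = x by rewrite /j1 /= linearD s00 s01 addr0.
have p1j0 x : p1 (j0 x) = k x by rewrite /j0 /= linearD s10 s11 add0r.
have p1j1 x : p1 (j1 x) = x + k x by rewrite /j1 /= linearD s10 s11 add0r.
have q1i0 x : q1 (i0 x) = - k x
  by rewrite -[LHS]/(p1 (i0 x) - k (p0 (i0 x))) s10 s00 sub0r.
have q1i1 x : q1 (i1 x) = x
  by rewrite -[LHS]/(p1 (i1 x) - k (p0 (i1 x))) s11 s01 (linear0 k) subr0.
have q0i0 x : q0 (i0 x) = x + k x.
  by rewrite -[LHS]/(p0 (i0 x) - q1 (i0 x)) s00 q1i0 opprK.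
have q0i1 x : q0 (i1 x) = - x.
  by rewrite -[LHS]/(p0 (i1 x) - q1 (i1 x)) s01 q1i1 sub0r.
have NE x : N x = p1 x + M x by [].
have vE x : v x = j0 (N (q1 x)) + j1 (M (q0 x)) by [].
split=> // x; rewrite vE.
- by rewrite linearD t00 t01 t10 !linear0 addr0.
- by rewrite linearD t11 t01 t10 !linear0 addr0.
- rewrite linearD p0j0 p0j1 q1i0 q0i0 (linearN N) (linearD M) NE.
  have -> : p1 (k x) = M x - A x.
    by rewrite -[k x]/(h x - i1 (A x)) linearB s11.
  by rewrite opprD opprB -[A x - _ - _]addrA -opprD subrK.
- rewrite linearD p1j0 p1j1 q1i1 q0i1 (linearN M) (linearN k) -opprD.
  rewrite NE (linearD k) addrC opprD addrA.
  have -> : k (p1 x) = h (p1 x) - i1 (A (p1 x)) by [].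
  by rewrite addrAC subrK addrA [- _ + _]addrC hP; apply: addrK.
Qed.

Lemma four_quadratic_sum e (i0 i1 p0 p1 u : {linear V -> V}) :
  split_twice i0 i1 p0 p1 -> (forall x, exists n, iter n p1 x = 0) ->
  exists a b c d : {linear V -> V},
    [/\ forall x, a (a x) = e *: a x, forall x, b (b x) = e *: b x,
        forall x, c (c x) = e *: c x & forall x, d (d x) = e *: d x] /\
    u =1 a \+ b \+ c \+ d.
Proof.
move=> sp nil.
(* Subtracting e twice leaves one e for each of the off-diagonal parts [w \- v] and [v]. *)
pose w : {linear V -> V} := u \- ((e \*: idfun) \+ (e \*: idfun)).
have [v [j0 [j1 [q0 [q1 [sq v00 v11 vA vD]]]]]] := off_diagonal_part w sp nil.
have [|| a [b [aa bb ab]]] :=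
  off_diagonal_quadratic_sum e (v := w \- v) sp.
- by move=> x; rewrite [LHS]/= linearB /= -/(w _) vA subrr.
- by move=> x; rewrite [LHS]/= linearB /= -/(w _) vD subrr.
have [c [d [cc dd cd]]] := off_diagonal_quadratic_sum e sq v00 v11.
exists a, b, c, d; split=> // x; rewrite /= -addrA -ab -cd /=.
by rewrite addrACA subrK subrK.
Qed.

End Blocks.

(** * Bases, and the identification of V with V + V *)

Section Bases.
Variables (F : fieldType) (V : lmodType F).
Implicit Types (B : set V) (phi : V -> V).

(* The linear relation spanned by the pairs (v, phi v) with v in B: the graph
   of the linear extension of phi, when B is independent. *)
Inductive span_graph B phi : V -> V -> Prop :=
| SpanGraph0 : span_graph B phi 0 0
| SpanGraphS c v x y : B v -> span_graph B phi x y ->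
    span_graph B phi (c *: v + x) (c *: phi v + y).

Definition span B x := exists y, span_graph B idfun x y.

(** A linear relation in B must survive every [phi]; a [phi] that is nonzero at a single vector of B
    then isolates its coefficient. *)
Definition independent B := forall phi y, span_graph B phi 0 y -> y = 0.

Lemma span_graph_linear B phi c x1 y1 x2 y2 :
  span_graph B phi x1 y1 -> span_graph B phi x2 y2 ->
  span_graph B phi (c *: x1 + x2) (c *: y1 + y2).
Proof.
move=> g1 g2; elim: g1 => [|d v x y Bv _ IH]; first by rewrite !scaler0 !add0r.
by rewrite !scalerDr !scalerA -!addrA; apply: SpanGraphS.
Qed.

Lemma span_graph_ex B phi psi x y :
  span_graph B phi x y -> exists z, span_graph B psi x z.
Proof.
elim=> [|c v {}x {}y Bv _ [z gz]]; first by exists 0; constructor.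
by exists (c *: psi v + z); constructor.
Qed.

Lemma span_graph_fun B phi x y z : independent B ->
  span_graph B phi x y -> span_graph B phi x z -> y = z.
Proof.
move=> indB gy gz; apply/eqP; rewrite -subr_eq0; apply/eqP/(indB phi).
by have := span_graph_linear (-1) gz gy; rewrite !scaleN1r addNr addrC.
Qed.

(** Finitely many vectors of the union lie in one member of the chain; the zero pair stands apart
    because the chain may be empty. *)
Lemma span_graph_bigcup (Fs : set (set V)) phi x y :
  total_on Fs subset -> span_graph (\bigcup_(X in Fs) X)%classic phi x y ->
  x = 0 /\ y = 0 \/ exists2 X, Fs X & span_graph X phi x y.
Proof.
move=> totF; have mono X Y : (X `<=` Y)%classic -> forall x y,
    span_graph X phi x y -> span_graph Y phi x y.
  move=> XY ? ?; elim=> [|c v ? ? /XY Yv _ g]; first by constructor.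
  exact: SpanGraphS.
elim=> [|c v {}x {}y [X FX Xv] _ [[-> ->]|[Y FY gY]]]; first by left.
  by right; exists X => //; constructor=> //; constructor.
right; have [XY|YX] := totF _ _ FX FY.
  by exists Y => //; constructor=> //; apply: XY.
by exists X => //; constructor=> //; apply: mono gY.
Qed.

(** Once the multiples of v are collected, a nonzero coefficient would put v in the span of B. *)
Lemma independent_setU1 B v :
  independent B -> ~ span B v -> independent (B `|` [set v])%classic.
Proof.
move=> indB nBv phi y.
have split_v x z : span_graph (B `|` [set v])%classic phi x z ->
    exists c x' z', [/\ span_graph B phi x' z', x = c *: v + x'
      & z = c *: phi v + z'].
  elim=> [|c w {}x {}z Bw _ [d [x' [z' [g -> ->]]]]].
    by exists 0, 0, 0; split; rewrite ?scale0r ?add0r //; constructor.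
  case: Bw => [Bw|->].
    exists d, (c *: w + x'), (c *: phi w + z').
    by split; [constructor|rewrite addrCA|rewrite addrCA].
  by exists (c + d), x', z'; split=> //; rewrite scalerDl addrA.
move=> /split_v[c [x' [z' [g]]]].
have [-> |c0] := eqVneq c 0.
  move: g; rewrite !scale0r !add0r => g x0 ->.
  by apply: (indB phi); rewrite x0.
move=> /eqP; rewrite eq_sym addr_eq0 => /eqP cv _; case: nBv.
have [t gt] := span_graph_ex idfun g.
have -> : v = (- c^-1) *: x' + 0.
  by rewrite addr0 scaleNr -scalerN -cv scalerA mulVf // scale1r.
by eexists; apply: span_graph_linear gt (SpanGraph0 _ _).
Qed.

Lemma basis_exists : exists B, independent B /\ forall x, span B x.
Proof.
have [Fs indF totF|B [indB maxB]] := @Zorn_bigcup _ independent.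
  move=> phi y /(span_graph_bigcup totF)[[_ ->]//|[X /indF indX]].
  exact: indX.
exists B; split=> // x; apply: contrapT => nBx.
apply: (maxB (B `|` [set x])%classic); last exact: independent_setU1.
split=> [v Bv|/(_ x (or_intror erefl)) Bx]; first by left.
apply: nBx; exists (1 *: x + 0); rewrite -[x in span_graph _ _ x](addr0 x).
by rewrite -[x in span_graph _ _ (x + _)]scale1r; constructor=> //; constructor.
Qed.

Lemma span_ind B (P : V -> Prop) :
  P 0 -> (forall c v x, B v -> P x -> P (c *: v + x)) ->
  forall x, span B x -> P x.
Proof. by move=> P0 PS x [y]; elim=> // c v ? ? Bv _; apply: PS. Qed.

Lemma linear_extension B phi : independent B -> (forall x, span B x) ->
  exists g : {linear V -> V}, forall v, B v -> g v = phi v.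
Proof.
move=> indB spanB.
(* Independence makes the graph single-valued, hence the chosen values linear in [x]. *)
have /choice[f fP] x : exists y, span_graph B phi x y.
  by have [y /span_graph_ex] := spanB x; apply.
have [|g gE] := @pack_linear F V f.
  move=> c x y; apply: (span_graph_fun indB (fP _)).
  exact: span_graph_linear.
exists g => v Bv; rewrite gE; apply: (span_graph_fun indB (fP _)).
rewrite -[v in span_graph _ _ v](addr0 v) -[phi v]addr0.
rewrite -[v in span_graph _ _ (v + _)]scale1r -[phi v]scale1r.
by constructor=> //; constructor.
Qed.

Lemma basis_infinite B :
  infinite_dimensional V -> (forall x, span B x) -> infinite_set B.
Proof.
move=> infV spanB /finite_seqP[s Bs]; apply: infV.
exists (size s), (fun i => s`_i) => x.
move: x (spanB x); apply: span_ind => [|c v x].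
  by exists (fun=> 0); rewrite big1 // => i _; rewrite scale0r.
rewrite Bs /= => vs [d ->].
have vi : (index v s < size s)%N by rewrite index_mem.
exists (fun i => c *+ (i == Ordinal vi) + d i).
under [RHS]eq_bigr do rewrite scalerDl.
rewrite big_split; congr (_ + _).
rewrite (bigD1 (Ordinal vi)) //= eqxx nth_index // big1 ?addr0 //.
by move=> i /negPf ->; rewrite scale0r.
Qed.

(** With the basis arranged in sequences [e j], the even and the odd positions each give a copy of
    V. The odd projection lowers positions, hence is locally nilpotent. *)
Lemma infinite_split_twice : infinite_dimensional V ->
  exists i0 i1 p0 p1 : {linear V -> V},
    split_twice i0 i1 p0 p1 /\ forall x, exists n, iter n p1 x = 0.
Proof.
move=> infV; have [B [indB spanB]] := basis_exists.
have [J [e [eB e_inj]]] := infinite_set_sequences (basis_infinite infV spanB).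
have ext (f : J -> nat -> V) :
    exists g : {linear V -> V}, forall j n, g (e j n) = f j n.
  have /choice[phi phiP] v : exists y, forall j n, v = e j n -> y = f j n.
    have [[j [n ->]]|nv] := pselect (exists j n, v = e j n).
      by exists (f j n) => i m /e_inj[-> ->].
    by exists 0 => j n vE; case: nv; exists j, n.
  have [g gE] := linear_extension phi indB spanB.
  exists g => j n; rewrite gE; first exact: phiP.
  by apply/eB; exists j, n.
have ind (P : V -> Prop) : P 0 ->
    (forall c j n x, P x -> P (c *: e j n + x)) -> forall x, P x.
  move=> P0 PS x; apply: (span_ind P0 _ (spanB x)) => c v y.
  by move=> /eB[j [n ->]]; apply: PS.
have eq_lin (g h : {linear V -> V}) :
    (forall j n, g (e j n) = h (e j n)) -> g =1 h.
  move=> gh; apply: ind => [|c j n x IH]; first by rewrite !linear0.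
  by rewrite !linearP gh IH.
have [i0 i0E] := ext (fun j n => e j n.*2).
have [i1 i1E] := ext (fun j n => e j n.*2.+1).
have [p0 p0E] := ext (fun j n => if odd n then 0 else e j n./2).
have [p1 p1E] := ext (fun j n => if odd n then e j n./2 else 0).
exists i0, i1, p0, p1; split.
  split.
  - apply: (eq_lin (p0 \o i0) idfun) => j n /=.
    by rewrite i0E p0E odd_double doubleK.
  - apply: (eq_lin (p1 \o i1) idfun) => j n /=.
    by rewrite i1E p1E /= odd_double uphalf_double.
  - apply: (eq_lin (p0 \o i1) \0) => j n /=.
    by rewrite i1E p0E /= odd_double.
  - apply: (eq_lin (p1 \o i0) \0) => j n /=.
    by rewrite i0E p1E odd_double.
  - apply: (eq_lin ((i0 \o p0) \+ (i1 \o p1)) idfun) => j n /=.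
    rewrite p0E p1E; have := odd_double_half n.
    by case: odd => /= nE; rewrite ?i0E ?i1E linear0 ?addr0 ?add0r -[in RHS]nE.
have iter0 k : iter k p1 0 = 0 by elim: k => //= k ->; rewrite linear0.
(* [p1] kills [e j n] for even n and moves it to position [n./2 < n] for odd n. *)
have nil_e j n : iter n.+1 p1 (e j n) = 0.
  have [m] := ubnP n; elim: m n => // m IH n nm; rewrite iterSr p1E.
  case: (boolP (odd n)) => odd_n; last exact: iter0.
  have half_n : (n./2 < n)%N.
    rewrite -[X in (_ < X)%N]odd_double_half odd_n add1n ltnS.
    by rewrite -addnn leq_addr.
  rewrite -[X in iter X](subnK half_n) iterD IH ?iter0 //.
  exact: leq_trans half_n _.
apply: ind => [|c j n x [m xm]]; first by exists 0.
exists (m + n.+1)%N.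
have iter_lin k : linear (iter k p1).
  by elim: k => // k IH d y z; rewrite !iterS IH linearP.
rewrite iter_lin {1}iterD nil_e iter0 scaler0 add0r.
by rewrite addnC iterD xm iter0.
Qed.

End Bases.

Theorem corollary3 (F : fieldType) (V : lmodType F)
    (infV : infinite_dimensional V) :
  (forall u : {linear V -> V}, exists a b c d : {linear V -> V},
     [/\ square_zero a, square_zero b, square_zero c & square_zero d] /\
     u =1 a \+ b \+ c \+ d) /\
  (forall u : {linear V -> V}, exists p q r s : {linear V -> V},
     [/\ idempotent_fun p, idempotent_fun q, idempotent_fun r
       & idempotent_fun s] /\
     u =1 p \+ q \+ r \+ s).
Proof.
have [i0 [i1 [p0 [p1 [sp nil]]]]] := infinite_split_twice infV.
split=> u.
  have [a [b [c [d [[aa bb cc dd] uE]]]]] := four_quadratic_sum 0 u sp nil.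
  exists a, b, c, d; split=> //.
  by split=> x /=; rewrite (aa, bb, cc, dd) scale0r.
have [a [b [c [d [[aa bb cc dd] uE]]]]] := four_quadratic_sum 1 u sp nil.
exists a, b, c, d; split=> //.
by split=> x /=; rewrite (aa, bb, cc, dd) scale1r.
Qed.
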